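(* Let $R$ be a local ring such that the maximal ideal of $R$ contains a non-zerodivisor of $R$. Assume that the maximal ideal of $R$ is either a principal ideal or a non-divisorial ideal of $R$. Then there is no ring $T$ properly containing $R$ (as a subring) such that $\mathrm{Spec}(R)=\mathrm{Spec}(T)$.
   Context: All rings are commutative with nonzero identity, and subrings share the identity of the larger ring. A local ring is a ring with a unique maximal ideal (not necessarily Noetherian). $T(R)$ is the total quotient ring of $R$. For $R$-submodules $I,J$ of $T(R)$, $(I:J)=\{x\in T(R): xJ\subseteq I\}$. An ideal $I$ of $R$ is divisorial if $I=(R:(R:I))$. For a subring $R$ of $T$, $\mathrm{Spec}(R)=\mathrm{Spec}(T)$ means that $R$ and $T$ have literally the same prime ideals: every prime ideal of $R$ is (as a subset of $T$) a prime ideal of $T$, and every prime ideal of $T$ is contained in $R$ and is a prime ideal of $R$. The ring $T$ is not assumed to be contained in $T(R)$. *)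

(* Defs.v *)
From HB Require Import structures.
From mathcomp Require Import all_boot all_order all_algebra ring.
From mathcomp Require Import generic_quotient ring_quotient.
From mathcomp Require Import boolp classical_sets.

Set Implicit Arguments.
Unset Strict Implicit.
Unset Printing Implicit Defensive.

Import GRing.Theory.
Local Open Scope classical_set_scope.
Local Open Scope ring_scope.
Local Open Scope quotient_scope.

(* The total quotient ring T(R), obtained as in [mathcomp.algebra.fraction]
   (which only treats integral domains) as a quotient of the pairs (a, s) with
   s a non-zerodivisor, under (a, s) ~ (b, t) iff a t = b s.  In a commutative
   ring, [GRing.lreg s] (multiplication by s is injective) says exactly that s
   is a non-zerodivisor. *)
Module TotalQuotient.
Section TotalQuotient.
Variable R : comNzRingType.

Record preratio :=
  PreRatio { pair_of :> R * R; _ : `[< GRing.lreg pair_of.2 >] }.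

HB.instance Definition _ := [isSub for pair_of].
HB.instance Definition _ := [Choice of preratio by <:].

Implicit Types x y z : preratio.

Lemma denP x : GRing.lreg x.2.
Proof. by case: x => p /= /asboolP. Qed.

Definition ratio (a s : R) (hs : GRing.lreg s) : preratio :=
  @PreRatio (a, s) (introT (asboolP (GRing.lreg (a, s).2)) hs).

Definition equivr x y := x.1 * y.2 == y.1 * x.2.

Lemma equivr_refl : reflexive equivr.
Proof. by move=> x; rewrite /equivr. Qed.

Lemma equivr_sym : symmetric equivr.
Proof. by move=> x y; rewrite /equivr eq_sym. Qed.

Lemma equivr_trans : transitive equivr.
Proof.
move=> y x z; rewrite /equivr => /eqP xy /eqP yz.
apply/eqP/(@denP y); transitivity ((x.1 * y.2) * z.2); first by ring.
by rewrite xy mulrAC yz; ring.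
Qed.

Canonical equivr_equiv := EquivRel equivr equivr_refl equivr_sym equivr_trans.

Definition type := {eq_quot equivr}.

HB.instance Definition _ : EqQuotient _ equivr type := EqQuotient.on type.
HB.instance Definition _ := Choice.on type.

Implicit Types a b c : type.

Lemma pi_eq x y : (\pi_type x = \pi_type y) <-> (x.1 * y.2 = y.1 * x.2).
Proof. by split=> [/eqmodP/eqP|h] //; apply/eqmodP/eqP. Qed.

Lemma reprE x : (repr (\pi_type x)).1 * x.2 = x.1 * (repr (\pi_type x)).2.
Proof. by apply/pi_eq; rewrite reprK. Qed.

Definition addr x y := ratio (x.1 * y.2 + y.1 * x.2) (GRing.lregM (@denP x) (@denP y)).
Definition oppr x := ratio (- x.1) (@denP x).
Definition mulr x y := ratio (x.1 * y.1) (GRing.lregM (@denP x) (@denP y)).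

Definition frac (r : R) : type := \pi_type (ratio r (@lreg1 R)).
Definition add := lift_op2 type addr.
Definition opp := lift_op1 type oppr.
Definition mul := lift_op2 type mulr.

Lemma addE x y : add (\pi_type x) (\pi_type y) = \pi_type (addr x y).
Proof.
unlock add; apply/pi_eq => /=; have := reprE x; have := reprE y.
move: (repr (\pi_type x)) (repr (\pi_type y)) => x' y' hy hx.
transitivity ((x'.1 * x.2) * (y'.2 * y.2) + (y'.1 * y.2) * (x'.2 * x.2)).
  by ring.
by rewrite hx hy; ring.
Qed.

Lemma oppE x : opp (\pi_type x) = \pi_type (oppr x).
Proof. by unlock opp; apply/pi_eq => /=; rewrite !mulNr reprE. Qed.

Lemma mulE x y : mul (\pi_type x) (\pi_type y) = \pi_type (mulr x y).
Proof. by unlock mul; apply/pi_eq => /=; rewrite mulrACA (reprE x) (reprE y) mulrACA. Qed.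

Lemma addA : associative add.
Proof.
elim/quotW=> x; elim/quotW=> y; elim/quotW=> z; rewrite !addE.
by apply/pi_eq => /=; ring.
Qed.

Lemma addC : commutative add.
Proof.
by elim/quotW=> x; elim/quotW=> y; rewrite !addE; apply/pi_eq => /=; ring.
Qed.

Lemma add0 : left_id (frac 0) add.
Proof. by elim/quotW=> x; rewrite addE; apply/pi_eq => /=; ring. Qed.

Lemma addN : left_inverse (frac 0) opp add.
Proof. by elim/quotW=> x; rewrite oppE addE; apply/pi_eq => /=; ring. Qed.

HB.instance Definition _ := GRing.isZmodule.Build type addA addC add0 addN.

Lemma mulA : associative mul.
Proof.
elim/quotW=> x; elim/quotW=> y; elim/quotW=> z; rewrite !mulE.
by apply/pi_eq => /=; ring.
Qed.

Lemma mulC : commutative mul.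
Proof.
by elim/quotW=> x; elim/quotW=> y; rewrite !mulE; apply/pi_eq => /=; ring.
Qed.

Lemma mul1 : left_id (frac 1) mul.
Proof. by elim/quotW=> x; rewrite mulE; apply/pi_eq => /=; ring. Qed.

Lemma mulD : left_distributive mul add.
Proof.
elim/quotW=> x; elim/quotW=> y; elim/quotW=> z; rewrite !(addE, mulE).
by apply/pi_eq => /=; ring.
Qed.

Lemma frac_inj : injective frac.
Proof. by move=> r s /pi_eq /=; rewrite !mulr1. Qed.

Lemma one_neq0 : frac 1 != frac 0.
Proof. by apply/eqP => /frac_inj/eqP; rewrite oner_eq0. Qed.

HB.instance Definition _ :=
  GRing.Zmodule_isComNzRing.Build type mulA mulC mul1 mulD one_neq0.

Lemma frac_is_zmod_morphism : zmod_morphism frac.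
Proof.
move=> r s; rewrite -[RHS]/(add (frac r) (opp (frac s))) oppE addE.
by apply/pi_eq => /=; ring.
Qed.

HB.instance Definition _ :=
  GRing.isZmodMorphism.Build R type frac frac_is_zmod_morphism.

Lemma frac_is_monoid_morphism : monoid_morphism frac.
Proof.
split=> // r s; rewrite -[RHS]/(mul (frac r) (frac s)) mulE.
by apply/pi_eq => /=; ring.
Qed.

HB.instance Definition _ :=
  GRing.isMonoidMorphism.Build R type frac frac_is_monoid_morphism.

Lemma frac_lreg (s : R) : GRing.lreg s -> exists b, b * frac s = 1.
Proof.
move=> hs; exists (\pi_type (ratio 1 hs)); rewrite -[LHS]/(mul (\pi_type _) (frac s)) mulE.
by apply/pi_eq => /=; ring.
Qed.

Lemma fracP a : exists r s : R, GRing.lreg s /\ a * frac s = frac r.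
Proof.
elim/quotW: a => x; exists x.1, x.2; split; first exact: (@denP x).
by rewrite -[LHS]/(mul (\pi_type x) (frac x.2)) mulE; apply/pi_eq => /=; ring.
Qed.

End TotalQuotient.
End TotalQuotient.
HB.export TotalQuotient.

Notation total_quotient := TotalQuotient.type.
(* the canonical embedding R -> T(R) *)
Notation tofracT := (@TotalQuotient.frac _).

Section Ideals.
Variable R : comNzRingType.
Implicit Types I J m p : set R.

(* [idealr_closed] includes 1 \notin I, so this is a proper ideal. *)
Definition proper_ideal_set I : Prop := idealr_closed [in I].

Definition prime_ideal_set p : Prop :=
  proper_ideal_set p /\ prime_idealr_closed [in p].

Definition Spec : set (set R) := [set p | prime_ideal_set p].

Definition maximal_ideal_set m : Prop :=
  proper_ideal_set m /\ forall I, proper_ideal_set I -> m `<=` I -> I = m.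

Definition local_ring_with m : Prop :=
  maximal_ideal_set m /\ forall n, maximal_ideal_set n -> n = m.

Definition principal_ideal_set I : Prop :=
  exists a : R, I = range (fun r : R => r * a).

(* (I : J), formed in T(R); the arguments are subsets of T(R). *)
Definition colon (I J : set (total_quotient R)) : set (total_quotient R) :=
  [set x | forall y, J y -> I (x * y)].

(* I = (R : (R : I)), with R and I identified with their images in T(R). *)
Definition divisorial I : Prop :=
  tofracT @` I = colon (range tofracT) (colon (range tofracT) (tofracT @` I)).

Lemma proper_ideal_setP I :
  proper_ideal_set I <->
  [/\ I 0, ~ I 1 & forall a u v, I u -> I v -> I (a * u + v)].
Proof.
rewrite /proper_ideal_set /idealr_closed; split=> -[h0 h1 hD].
  split=> [||a u v hu hv]; first by move: h0; rewrite inE.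
    by move=> h; case/negP: h1; rewrite inE.
  by have := hD a u v; rewrite !inE; apply.
split; rewrite ?inE //; first by apply/negP; rewrite inE.
by move=> a u v; rewrite !inE; apply: hD.
Qed.

Lemma prime_ideal_setP p :
  prime_ideal_set p <->
  proper_ideal_set p /\ forall u v, p (u * v) -> p u \/ p v.
Proof.
split=> -[hp h]; split=> // u v.
  move=> huv; have := h u v; rewrite !inE => /(_ huv)/orP.
  by rewrite !inE.
by rewrite inE => /h huv; apply/orP; rewrite !inE.
Qed.

End Ideals.

Arguments Spec R p : clear implicits.

(* R is viewed as a subring of T through an injective ring morphism f; the sets
   of primes are then compared literally, as sets of subsets of T. *)
Definition same_Spec (R T : comNzRingType) (f : {rmorphism R -> T}) : Prop :=
  [set f @` p | p in Spec R] = Spec T.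

(* Main.v *)
(** A ring T with the same primes as R has the maximal ideal m of R as an ideal,
    and every element of T outside m is a unit of T; hence a non-zerodivisor of
    R lying in m stays a non-zerodivisor in T.  If m = aR, then t a lies in aR
    for every t in T, and cancelling a puts t in R.  If m is not divisorial,
    then (R : m) = R; for x regular in m and t in T, the fraction (t x)/x
    multiplies m into m, so it lies in R, and cancelling x puts t in R. *)
Require Import Defs.
From mathcomp Require Import all_boot all_algebra.
From mathcomp Require Import boolp classical_sets.
From mathcomp Require Import ring.

Set Implicit Arguments.
Unset Strict Implicit.

Local Open Scope classical_set_scope.
Local Open Scope ring_scope.

Import GRing.Theory.

Section ProperIdeals.
Variable R : comNzRingType.
Implicit Types I m p : set R.

Lemma proper_ideal_mull I a u : proper_ideal_set I -> I u -> I (a * u).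
Proof. by move=> /proper_ideal_setP[h0 _ hD] hu; rewrite -[_ * _]addr0; apply: hD. Qed.

Lemma proper_ideal_add I u v : proper_ideal_set I -> I u -> I v -> I (u + v).
Proof. by move=> /proper_ideal_setP[_ _ hD] hu hv; rewrite -[u]mul1r; apply: hD. Qed.

Lemma proper_ideal_sub_maximal I :
  proper_ideal_set I -> exists2 m, maximal_ideal_set m & I `<=` m.
Proof.
move=> Iid.
(* Zorn_bigcup also needs an upper bound for the empty chain, whence [I `|` A]. *)
have [F FP Ftot|A [Aid Amax]] :=
    @Zorn_bigcup R [set A | proper_ideal_set (I `|` A)].
  have [neF|F0] := pselect (exists X, F X); last first.
    have -> : \bigcup_(X in F) X = set0.
      by rewrite -subset0 => x [X FX _]; apply: F0; exists X.
    by rewrite /= setU0.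
  have [I0 I1 _] := (proper_ideal_setP _).1 Iid.
  have in_member u : (I `|` \bigcup_(X in F) X) u -> exists2 X, F X & (I `|` X) u.
    case=> [Iu|[X FX Xu]]; last by exists X => //; right.
    by case: neF => X FX; exists X => //; left.
  apply: (proper_ideal_setP _).2; split=> [||a u v]; first by left.
    case/in_member => X /FP/= /proper_ideal_setP[_ X1 _] ?; exact: X1.
  move=> /in_member[X FX Xu] /in_member[Y FY Yv].
  have [Z FZ [Zu Zv]] : exists2 Z, F Z & (I `|` Z) u /\ (I `|` Z) v.
    have [XY|YX] := Ftot _ _ FX FY.
      by exists Y => //; split=> //; apply: setUS Xu.
    by exists X => //; split=> //; apply: setUS Yv.
  have /proper_ideal_setP[_ _ hD] := FP _ FZ.
  by have [|Zw] := hD a u v Zu Zv; [left|right; exists Z].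
exists (I `|` A); last exact: subsetUl.
split=> // J Jid IAJ.
apply/seteqP; split=> //.
(* Otherwise [J] strictly contains [A] and, since [I] lies in [J], belongs to the Zorn family
   itself. *)
apply: contrapT => nJ; apply: (Amax J).
  split=> [x Ax|JA]; first by apply: IAJ; right.
  by apply: nJ => x /JA; right.
by rewrite /= setUidr//; apply: subset_trans IAJ; exact: subsetUl.
Qed.

(** If 1 were not of this form, then m + Ru (the set [J] below) would be a proper ideal containing
    m, hence equal to m, although it contains u. *)
Lemma maximal_ideal_comaximal m u :
  maximal_ideal_set m -> ~ m u -> exists a y, m y /\ a * u + y = 1.
Proof.
move=> [mid mmax] mu; apply: contrapT => h.
have [m0 m1 mD] := (proper_ideal_setP _).1 mid.
pose J := [set z | exists a y, m y /\ a * u + y = z].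
have Jid : proper_ideal_set J.
  apply: (proper_ideal_setP _).2; split=> //; first by exists 0, 0; rewrite mul0r addr0.
  move=> c _ _ [a [y [my <-]]] [b [z [mz <-]]].
  by exists (c * a + b), (c * y + z); split; [exact: mD | ring].
apply: mu; rewrite -(mmax J Jid).
  by exists 1, 0; rewrite mul1r addr0.
by move=> y my; exists 0, y; rewrite mul0r add0r.
Qed.

Lemma maximal_ideal_prime m : maximal_ideal_set m -> prime_ideal_set m.
Proof.
move=> mmax; apply: (prime_ideal_setP _).2; split=> [|u v muv]; first by case: mmax.
have [mu|mu] := pselect (m u); [by left|right].
have [a [y [my e]]] := maximal_ideal_comaximal mmax mu.
have -> : v = a * (u * v) + v * y by rewrite -[LHS]mulr1 -e; ring.
by apply: (proper_ideal_add mmax.1); apply: (proper_ideal_mull _ mmax.1).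
Qed.

Lemma local_ring_proper_sub m I :
  local_ring_with m -> proper_ideal_set I -> I `<=` m.
Proof. by move=> [_ muniq] /proper_ideal_sub_maximal[n /muniq->]. Qed.

(** For a non-unit u the ideal uR is proper, so it lies in a maximal ideal, which is prime. *)
Lemma notin_primes_unit (u : R) :
  (forall p, prime_ideal_set p -> ~ p u) -> exists v, v * u = 1.
Proof.
move=> hu; apply: contrapT => nv.
have [|n nmax un] := @proper_ideal_sub_maximal (range (fun r => r * u)).
  apply: (proper_ideal_setP _).2; split=> [|[v _ vu]|a _ _ [b _ <-] [c _ <-]].
  - by exists 0; rewrite ?mul0r.
  - by apply: nv; exists v.
  - by exists (a * b + c) => //; ring.
apply: (hu n); first exact: maximal_ideal_prime.
by apply: un; exists 1; rewrite ?mul1r.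
Qed.

(** By contraposition: given q in (R : m) outside R, every z in (R : (R : m)) has to lie in m. It
    lies in R because 1 is in (R : m). *)
Lemma nondivisorial_colon m : maximal_ideal_set m -> ~ divisorial m ->
  colon (range tofracT) (tofracT @` m) `<=` range (@TotalQuotient.frac R).
Proof.
move=> mmax; apply: contra_notP.
move=> /existsNP[q /not_implyP[qm qR]]; apply/seteqP; split=> [_ [y my <-] s|z hz].
  by rewrite mulrC; apply; exists y.
have [r _ rz] : range tofracT z.
  by rewrite -[z]mulr1; apply: hz => _ [y _ <-]; rewrite mul1r; exists y.
exists r => //; apply: contrapT => mr.
(* From a r + y = 1 follows q = a (r q) + y q, where r q and y q are both in R; so q would be in
   R. *)
have [a [y [my e]]] := maximal_ideal_comaximal mmax mr.
have [b _ eb] := hz q qm.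
have [|c _ ec] := qm (tofracT y); first by exists y.
apply: qR; exists (a * b + c) => //.
have := rmorph1 (@TotalQuotient.frac R); rewrite -e !rmorphD !rmorphM /= eb ec rz => e1.
by rewrite -[RHS]mul1r -e1; ring.
Qed.

End ProperIdeals.

Section SameSpec.
Variables (R T : comNzRingType) (f : {rmorphism R -> T}) (m : set R).
Hypotheses (Rlocal : local_ring_with m) (finj : injective f) (fSpec : same_Spec f).

Lemma same_Spec_maximal_mull (t : T) (x : R) :
  m x -> exists2 y, m y & f y = t * f x.
Proof.
move=> mx; have : Spec T (f @` m).
  by rewrite -fSpec; exists m => //; apply: maximal_ideal_prime Rlocal.1.
by move=> [fm_id _]; apply: (proper_ideal_mull t fm_id); exists x.
Qed.

(** Let u kill f(x). If u is in f(m), cancel x inside R. Otherwise u avoids all primes of T, since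
    they are images of ideals contained in m; then u is a unit and x = 0, which is absurd. *)
Lemma same_Spec_lreg (x : R) : m x -> GRing.lreg x -> GRing.lreg (f x).
Proof.
move=> mx xreg.
suff ann0 u : u * f x = 0 -> u = 0.
  move=> s t /eqP; rewrite -subr_eq0 -mulrBr mulrC => /eqP/ann0/eqP.
  by rewrite subr_eq0 => /eqP.
move=> ux0; have [[y my yu]|mu] := pselect ((f @` m) u).
  rewrite -yu in ux0 *; suff -> : y = 0 by rewrite rmorph0.
  apply: xreg; rewrite mulr0 mulrC; apply: finj.
  by rewrite rmorphM ux0 rmorph0.
have [p pT|v vu] := @notin_primes_unit T u.
  have [q [qid _] <-] : [set f @` p | p in Spec R] p by rewrite fSpec.
  move=> [y qy yu]; apply: mu; exists y => //.
  exact: local_ring_proper_sub Rlocal qid _ qy.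
have x0 : x = 0.
  by apply: finj; rewrite rmorph0 -[f x]mul1r -vu -mulrA ux0 mulr0.
have /eqP : 1 = 0 :> R by apply: xreg; rewrite x0 !mul0r.
by rewrite oner_eq0.
Qed.

End SameSpec.

Unset Implicit Arguments.

Theorem corollary2p20 (R : comNzRingType) (m : set R)
    (Rlocal : local_ring_with m)
    (mreg : exists2 x : R, m x & GRing.lreg x)
    (mPD : principal_ideal_set m \/ ~ divisorial m) :
  ~ exists (T : comNzRingType) (f : {rmorphism R -> T}),
      [/\ injective f, range f <> setT & same_Spec f].
Proof.
move=> [T [f [finj fsurj fSpec]]]; apply: fsurj; rewrite -subTset => t _.
have [x mx xreg] := mreg.
have mull := same_Spec_maximal_mull Rlocal fSpec.
case: mPD => [[a ma]|ndiv].
  have m_a : m a by rewrite ma; exists 1; rewrite ?mul1r.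
  (* The regular element x is a multiple of a, so a is regular too. *)
  have areg : GRing.lreg a.
    move: mx; rewrite ma => -[r _ ra] b c abc; apply: xreg.
    by rewrite -ra -!mulrA abc.
  have [y] := mull t a m_a; rewrite {1}ma => -[r _ <-] ta.
  exists r => //; apply: (same_Spec_lreg Rlocal finj fSpec m_a areg).
  by rewrite mulrC -rmorphM ta mulrC.
have [y my tx] := mull t x mx.
have [b bx] := TotalQuotient.frac_lreg xreg.
(* Here b = 1/x and y = t x. For z in m, the element w = t z of m satisfies y z = w x, so (y/x) z =
   w. *)
have [|r _ rb] := @nondivisorial_colon _ _ Rlocal.1 ndiv (b * tofracT y).
  move=> _ [z mz <-]; have [w mw tz] := mull t z mz; exists w => //.
  have yz : y * z = w * x by apply: finj; rewrite !rmorphM /= tx tz mulrAC.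
  by rewrite -mulrA -rmorphM yz rmorphM mulrCA bx mulr1.
exists r => //; apply: (same_Spec_lreg Rlocal finj fSpec mx xreg).
(* It remains to see x r = y in R, which is read off from r = y/x in T(R). *)
rewrite mulrC [RHS]mulrC -tx -rmorphM; congr (f _).
apply: TotalQuotient.frac_inj.
by rewrite rmorphM /= rb mulrAC bx mul1r.
Qed.
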